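(* Let $n$ be a positive integer. The monoid $M_n(\mathbb{Z}_{\max})$ is finitely presented if and only if $n = 1$.
   Context: $\mathbb{Z}_{\max} = \mathbb{Z}\cup\{-\infty\}$ is the tropical integer semiring, with semiring addition $\max$ and semiring multiplication the usual addition; its semiring zero is $-\infty$ and its semiring one is $0$. $M_n(\mathbb{Z}_{\max})$ is the monoid of all $n\times n$ matrices over $\mathbb{Z}_{\max}$ under (tropical) matrix multiplication. A monoid $\mathcal{S}$ is finitely presented if there exist a finite alphabet $\Sigma$ and a finite $R\subseteq\Sigma^*\times\Sigma^*$ (with $\Sigma^*$ the free monoid on $\Sigma$) such that $\mathcal{S}\cong\Sigma^*/\rho_R$, where $\rho_R$ is the smallest congruence on $\Sigma^*$ containing $R$. *)

(* Defs.v *)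
From HB Require Import structures.
From mathcomp Require Import all_boot all_order all_algebra.
From mathcomp Require Import boolp.

Set Implicit Arguments.
Unset Strict Implicit.
Unset Printing Implicit Defensive.

Import Order.TTheory GRing.Theory Num.Theory.

(* [None] is -oo, the semiring zero; the semiring one is [Some 0]. *)
Definition Zmax : Type := option int.

HB.instance Definition _ := Choice.on Zmax.

Section ZmaxSemiRing.
Local Open Scope ring_scope.

Definition Zmax_add (x y : Zmax) : Zmax :=
  match x, y with
  | None, _ => y
  | _, None => x
  | Some a, Some b => Some (Num.max a b)
  end.

Definition Zmax_mul (x y : Zmax) : Zmax :=
  match x, y with
  | Some a, Some b => Some (a + b)
  | _, _ => None
  end.

Definition Zmax_zero : Zmax := None.
Definition Zmax_one : Zmax := Some 0.

Lemma Zmax_addA : associative Zmax_add.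
Proof. by move=> [a|] [b|] [c|] //=; rewrite maxA. Qed.

Lemma Zmax_addC : commutative Zmax_add.
Proof. by move=> [a|] [b|] //=; rewrite maxC. Qed.

Lemma Zmax_add0 : left_id Zmax_zero Zmax_add.
Proof. by case. Qed.

Lemma Zmax_mulA : associative Zmax_mul.
Proof. by move=> [a|] [b|] [c|] //=; rewrite addrA. Qed.

Lemma Zmax_mulC : commutative Zmax_mul.
Proof. by move=> [a|] [b|] //=; rewrite addrC. Qed.

Lemma Zmax_mul1 : left_id Zmax_one Zmax_mul.
Proof. by move=> [a|] //=; rewrite add0r. Qed.

Lemma Zmax_mulDl : left_distributive Zmax_mul Zmax_add.
Proof. by move=> [a|] [b|] [c|] //=; rewrite addr_maxl. Qed.

Lemma Zmax_mul0 : left_zero Zmax_zero Zmax_mul.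
Proof. by []. Qed.

Lemma Zmax_one_neq0 : Zmax_one != Zmax_zero.
Proof. by []. Qed.

HB.instance Definition _ :=
  GRing.isNmodule.Build Zmax Zmax_addA Zmax_addC Zmax_add0.
HB.instance Definition _ := GRing.Nmodule_isComNzSemiRing.Build Zmax
  Zmax_mulA Zmax_mulC Zmax_mul1 Zmax_mulDl Zmax_mul0 Zmax_one_neq0.

End ZmaxSemiRing.

(* MathComp does not see a semiring as a multiplicative [monoidType]; this
   alias carries that structure. *)
Definition mulMonoid (R : pzSemiRingType) : Type := R.

HB.instance Definition _ (R : pzSemiRingType) := Choice.on (mulMonoid R).
HB.instance Definition _ (R : pzSemiRingType) := isMonoid.Build (mulMonoid R)
  (@mulrA R) (@mul1r R) (@mulr1 R).

Definition freeMonoid (A : Type) : Type := seq A.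

HB.instance Definition _ (A : choiceType) := Choice.on (freeMonoid A).
HB.instance Definition _ (A : choiceType) := isMonoid.Build (freeMonoid A)
  (@catA A) (@cat0s A) (@cats0 A).

Local Open Scope group_scope.

Record monoidCongruence (M : monoidType) := MonoidCongruence {
  cong_rel :> M -> M -> Prop;
  cong_refl : forall x, cong_rel x x;
  cong_sym : forall x y, cong_rel x y -> cong_rel y x;
  cong_trans : forall x y z, cong_rel x y -> cong_rel y z -> cong_rel x z;
  cong_mul : forall x x' y y',
    cong_rel x x' -> cong_rel y y' -> cong_rel (x * y) (x' * y')
}.

Section QuotientMonoid.
Variables (M : monoidType) (c : monoidCongruence M).

(* [{eq_quot _}] quotients by a boolean relation; congruences need not be
   decidable, hence the classical reflection [asbool]. *)
Definition cong_bool : rel M := fun x y => `[< c x y >].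

Lemma cong_bool_refl : reflexive cong_bool.
Proof. by move=> x; apply/asboolP/cong_refl. Qed.

Lemma cong_bool_sym : symmetric cong_bool.
Proof. by move=> x y; apply/asboolP/asboolP; apply: cong_sym. Qed.

Lemma cong_bool_trans : transitive cong_bool.
Proof.
by move=> y x z /asboolP xy /asboolP yz; apply/asboolP/(cong_trans xy yz).
Qed.

Canonical cong_equiv_rel :=
  EquivRel cong_bool cong_bool_refl cong_bool_sym cong_bool_trans.

Definition quotientMonoid : Type := {eq_quot cong_equiv_rel}%qT.

HB.instance Definition _ := Choice.on quotientMonoid.
HB.instance Definition _ := EqQuotient.on quotientMonoid.

Local Open Scope quotient_scope.

Lemma eq_quotientMonoid x y : x = y %[mod quotientMonoid] <-> c x y.
Proof.
split=> [xy|xy]; first by apply/asboolP; apply/(@eqmodP _ cong_equiv_rel).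
by apply/(@eqmodP _ cong_equiv_rel)/asboolP.
Qed.

Definition quot_mul (X Y : quotientMonoid) : quotientMonoid :=
  \pi_quotientMonoid (repr X * repr Y).

Definition quot_one : quotientMonoid := \pi_quotientMonoid 1.

Lemma pi_quot_mul x y :
  \pi_quotientMonoid (x * y) =
  quot_mul (\pi_quotientMonoid x) (\pi_quotientMonoid y).
Proof.
by apply/eq_quotientMonoid/cong_mul; apply/eq_quotientMonoid; rewrite reprK.
Qed.

Lemma quot_mulA : associative quot_mul.
Proof.
move=> X Y Z; elim/quotW: X => x; elim/quotW: Y => y; elim/quotW: Z => z.
by rewrite -(pi_quot_mul y) -(pi_quot_mul x y) -2!pi_quot_mul mulgA.
Qed.

Lemma quot_1mul : left_id quot_one quot_mul.
Proof. by elim/quotW=> x; rewrite -pi_quot_mul mul1g. Qed.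

Lemma quot_mul1 : right_id quot_one quot_mul.
Proof. by elim/quotW=> x; rewrite -pi_quot_mul mulg1. Qed.

HB.instance Definition _ :=
  isMonoid.Build quotientMonoid quot_mulA quot_1mul quot_mul1.

End QuotientMonoid.

Section GeneratedCongruence.
Variables (M : monoidType) (R : seq (M * M)).

Definition gen_rel (x y : M) : Prop :=
  forall e : monoidCongruence M,
    (forall p, p \in R -> e p.1 p.2) -> e x y.

Lemma gen_rel_refl x : gen_rel x x.
Proof. by move=> e _; apply: cong_refl. Qed.

Lemma gen_rel_sym x y : gen_rel x y -> gen_rel y x.
Proof. by move=> xy e Re; apply/cong_sym/xy. Qed.

Lemma gen_rel_trans x y z : gen_rel x y -> gen_rel y z -> gen_rel x z.
Proof. by move=> xy yz e Re; apply: cong_trans (xy e Re) (yz e Re). Qed.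

Lemma gen_rel_mul x x' y y' :
  gen_rel x x' -> gen_rel y y' -> gen_rel (x * y) (x' * y').
Proof. by move=> xx' yy' e Re; apply: cong_mul; [apply: xx'|apply: yy']. Qed.

Definition generatedCongruence : monoidCongruence M :=
  MonoidCongruence gen_rel_refl gen_rel_sym gen_rel_trans gen_rel_mul.

Lemma generatedCongruence_sub p : p \in R -> generatedCongruence p.1 p.2.
Proof. by move=> Rp e; apply. Qed.

Lemma generatedCongruence_min (e : monoidCongruence M) :
  (forall p, p \in R -> e p.1 p.2) ->
  forall x y, generatedCongruence x y -> e x y.
Proof. by move=> Re x y; apply. Qed.

End GeneratedCongruence.

Definition monoid_isomorphic (M N : monoidType) : Prop :=
  exists f : M -> N, monoid.monoid_morphism f /\ bijective f.

Definition finitely_presented (S : monoidType) : Prop :=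
  exists (A : finType) (R : seq (freeMonoid A * freeMonoid A)),
    monoid_isomorphic S (quotientMonoid (generatedCongruence R)).

(* Main.v *)
Require Import Defs.
From mathcomp Require Import all_boot all_order all_algebra.
From mathcomp Require Import perm boolp zify.

(** In dimension 1 the monoid is the infinite cyclic group with a zero
    adjoined, presented by two mutually inverse generators and a zero
    ([finitely_presented_dim1]).

    In dimension at least 3 the monoid is not even finitely generated.  The
    matrices supported on the diagonal and the cyclic superdiagonal are
    irreducible: in any factorization one factor is monomial
    ([cycle_support_irreducible]).  An irreducible product of generators is
    therefore a single generator up to monomial factors on both sides.
    Multiplying by a monomial matrix shifts all permutation weights
    [\prod_i M i (s i)] by one common constant, so it preserves the differences
    between finite weights; on finitely many generators these differences are
    bounded, whereas for the cycle matrix with a single entry [a] they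
    reach [a].

    In dimension 2 finitely many relations do not suffice.  Put, for b > 0,
<<
    ( 0   0 )     ( 0 -oo ) ( 0   0 )     ( 0   -b ) ( 0 -oo )
    ( 0   b )  =  ( 0   0 ) ( -oo b )  =  ( -oo  0 ) ( 0   b ).
>>
    In a word whose value is this matrix, read the values of the successive
    prefixes.  They start monomial, may then have exactly one entry -oo, and
    finally become finite everywhere; while there is exactly one -oo, it stays
    in the same row ([hole_mul]).  That row distinguishes the two
    factorizations above.  A relation l = r can change it only if it
    replaces l by r after a monomial prefix and the value of l is finite
    everywhere.  But the absolute cross difference m11 + m22 - m12 - m21 of a
    finite matrix cannot increase under multiplication on the right
    ([cross_mul_full]) and is unchanged by monomial factors on the left, so in
    that case the value of l has absolute cross difference at least b
    ([prefix_hole_step]).  For b larger than the cross differences of all the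
    relators the row is an invariant, and the relations cannot identify the two
    factorizations. *)

Set Implicit Arguments.
Unset Strict Implicit.
Unset Printing Implicit Defensive.

Import Order.TTheory GRing.Theory Num.Theory.

(** * Presentations of monoids *)

Section Presentations.
Local Open Scope group_scope.

(** Transporting the projection along the isomorphism turns a presentation into
    an evaluation of words inside [S], where the monoid can be computed in. *)
Lemma presentation_eval (S : monoidType) : finitely_presented S ->
  exists (A : finType) (R : seq (freeMonoid A * freeMonoid A))
         (phi : freeMonoid A -> S),
    [/\ phi 1 = 1, {morph phi : u v / u * v},
        forall s, exists u, phi u = s
      & forall u v, phi u = phi v <-> generatedCongruence R u v].
Proof.
move=> [A [R [f [[f1 fM] [g fK gK]]]]].
pose pi : freeMonoid A -> quotientMonoid (generatedCongruence R) :=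
  \pi_(quotientMonoid (generatedCongruence R))%qT.
have piM u v : pi (u * v) = pi u * pi v by exact: pi_quot_mul.
exists A, R, (fun u => g (pi u)); split.
- by rewrite -[RHS]fK f1.
- by move=> u v; rewrite -[RHS]fK fM !gK piM.
- by move=> s; exists (repr (f s)); rewrite /pi reprK fK.
move=> u v; split => [/(can_inj gK)|uv]; first by move/eq_quotientMonoid.
by congr g; apply/eq_quotientMonoid.
Qed.

(** Since left multiplication by a letter preserves normal forms up to the
    relations, induction on words reduces every word to the normal form of its
    value; so the relations already imply every equality of values. *)
Lemma presented_by_normal_forms (S : monoidType) (A : finType)
    (R : seq (freeMonoid A * freeMonoid A))
    (phi : freeMonoid A -> S) (nf : S -> freeMonoid A) :
  phi 1 = 1 -> {morph phi : u v / u * v} ->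
  (forall p, p \in R -> phi p.1 = phi p.2) ->
  cancel nf phi -> nf 1 = 1 ->
  (forall a s, generatedCongruence R (a :: nf s) (nf (phi [:: a] * s))) ->
  finitely_presented S.
Proof.
move=> phi1 phiM phiR nfK nf1 nfS.
pose ker := @MonoidCongruence (freeMonoid A) (fun u v => phi u = phi v)
  (fun _ => erefl) (fun _ _ => @esym _ _ _) (fun _ _ _ => @etrans _ _ _ _)
  (fun u u' v v' (uu' : phi u = phi u') (vv' : phi v = phi v') =>
     etrans (etrans (phiM u v) (congr2 *%g uu' vv')) (esym (phiM u' v'))).
have sound u v : generatedCongruence R u v -> phi u = phi v.
  by move=> uv; apply: (uv ker).
have nfP u : generatedCongruence R u (nf (phi u)).
  elim: u => [|a u IHu]; first by rewrite [phi _]phi1 nf1; apply: cong_refl.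
  have -> : a :: u = ([:: a] : freeMonoid A) * u by [].
  rewrite phiM; apply: cong_trans (nfS a _).
  have -> : a :: nf (phi u) = ([:: a] : freeMonoid A) * nf (phi u) by [].
  by apply: cong_mul => //; apply: cong_refl.
exists A, R, (fun s => \pi_(quotientMonoid (generatedCongruence R))%qT (nf s)).
split; first split.
- by rewrite nf1.
- move=> s t; rewrite -[RHS]pi_quot_mul; apply/eq_quotientMonoid/cong_sym.
  by rewrite -{2}(nfK s) -{2}(nfK t) -phiM; apply: nfP.
exists (fun q => phi (repr q)) => [s|q].
  rewrite -[RHS]nfK; apply/sound/eq_quotientMonoid; exact: reprK.
rewrite -[RHS]reprK; apply/eq_quotientMonoid/cong_sym; exact: nfP.
Qed.

End Presentations.

(** * Dimension one *)

Section DimensionOne.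
Local Open Scope ring_scope.

(** The letters [Some true] and [Some false] are a generator of the units and its
    inverse, and [None] is the zero. *)
Definition Zmax_gen (a : option bool) : Zmax :=
  if a is Some b then Some (if b then 1 else -1) else None.

Definition Zmax_word (s : Zmax) : freeMonoid (option bool) :=
  match s with
  | None => [:: None]
  | Some (Posz k) => nseq k (Some true)
  | Some (Negz k) => nseq k.+1 (Some false)
  end.

Definition Zmax_rels :
    seq (freeMonoid (option bool) * freeMonoid (option bool)) :=
  [:: ([:: Some true; Some false], [::]); ([:: Some false; Some true], [::])]
  ++ [seq ([:: Some b; None], [:: None]) | b <- [:: true; false]]
  ++ [seq ([:: None; a], [:: None]) | a <- [:: Some true; Some false; None]].

Let eqR := generatedCongruence Zmax_rels.

Lemma Zmax_relP (u v w : freeMonoid (option bool)) :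
  (u, v) \in Zmax_rels -> eqR (u ++ w) (v ++ w).
Proof.
move=> uv; apply: (@cong_mul _ eqR u v w w); last exact: (cong_refl eqR).
exact: (@generatedCongruence_sub _ Zmax_rels (u, v)).
Qed.

Lemma Zmax_word_cons (a : option bool) (s : Zmax) :
  eqR (a :: Zmax_word s) (Zmax_word (Zmax_gen a * s)).
Proof.
have zero_nseq c k : eqR (None :: nseq k c) [:: None].
  elim: k => [|k IHk]; first exact: (cong_refl eqR).
  apply: cong_trans IHk; apply: (@Zmax_relP [:: None; c] [:: None]).
  by case: c => [[]|].
case: a => [[]|]; case: s => [[k|k]|] /=.
- exact: (cong_refl eqR).
- have -> : 1 + Negz k = - k%:Z by lia.
  apply: (@cong_trans _ eqR _ (nseq k (Some false))).
    exact: (@Zmax_relP [:: Some true; Some false] [::]).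
  by case: k => [|k]; [apply: (cong_refl eqR) | rewrite -NegzE; apply: cong_refl].
- exact: (@Zmax_relP [:: Some true; None] [:: None] [::]).
- case: k => [|k] /=; first exact: (cong_refl eqR).
  rewrite subn1.
  exact: (@Zmax_relP [:: Some false; Some true] [::]).
- rewrite add0n.
  exact: (cong_refl eqR).
- exact: (@Zmax_relP [:: Some false; None] [:: None] [::]).
- exact: zero_nseq.
- exact: (zero_nseq _ k.+1).
- exact: (@Zmax_relP [:: None; None] [:: None] [::]).
Qed.

Lemma Zmax_wordK : cancel Zmax_word (fun u => \prod_(a <- u) Zmax_gen a).
Proof.
have prod_nseq k b : \prod_(a <- nseq k (Some b)) Zmax_gen a =
    Some ((if b then 1 else -1) * k%:Z) :> Zmax.
  elim: k => [|k IHk]; first by rewrite big_nil mulr0.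
  by rewrite big_cons IHk; congr Some; case: b {IHk} => /=; lia.
case=> [[k|k]|]; rewrite /Zmax_word ?prod_nseq ?big_seq1 //.
  by rewrite mul1r.
by rewrite mulN1r NegzE.
Qed.

Lemma finitely_presented_dim1 : finitely_presented (mulMonoid 'M[Zmax]_1).
Proof.
apply: (@presented_by_normal_forms (mulMonoid 'M[Zmax]_1) (option bool)
  Zmax_rels (fun u => (\prod_(a <- u) Zmax_gen a)%:M)
  (fun M => Zmax_word ((M : 'M[Zmax]_1) 0 0))).
- by rewrite big_nil.
- by move=> u v; rewrite big_cat; exact: scalar_mxM.
- move=> p; rewrite -[p \in _]/(p \in (_ :: _)) !inE.
  by do ![case/orP] => /eqP -> /=; rewrite ?big_cons big_nil.
- by move=> M; rewrite Zmax_wordK -mx11_scalar.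
- by rewrite mxE.
- move=> a s; rewrite (_ : (_ * s)%g = Zmax_gen a *: (s : 'M[Zmax]_1)).
    by rewrite mxE; exact: Zmax_word_cons.
  by rewrite big_seq1 -mul_scalar_mx.
Qed.

End DimensionOne.

(** * Supports over the tropical integers *)

Section ZmaxFacts.
Local Open Scope ring_scope.

Lemma Zmax_mul_neq0 (x y : Zmax) : (x * y != 0) = (x != 0) && (y != 0).
Proof. by case: x y => [a|] [b|]. Qed.

Lemma Zmax_add_neq0 (x y : Zmax) : (x + y != 0) = (x != 0) || (y != 0).
Proof. by case: x y => [a|] [b|]. Qed.

End ZmaxFacts.

(** * Dimension two *)

Section DimensionTwo.
Local Open Scope ring_scope.

Implicit Types (K Y : 'M[Zmax]_2) (b : bool).

Lemma mulmx22E K Y i j : (K *m Y) i j = K i 0 * Y 0 j + K i 1 * Y 1 j.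
Proof.
by rewrite mxE !big_ord_recl big_ord0 addr0; congr (_ * _ + _ * _);
   congr (_ _ _); apply: val_inj.
Qed.

(** This shape and the next three are boolean functions of the support alone, so
    their behaviour under products is decided by running through all supports. *)
Definition full K := [&& K 0 0 != 0, K 0 1 != 0, K 1 0 != 0 & K 1 1 != 0].

(** The unique entry -oo of [K] lies in row [b], read as 0 or 1. *)
Definition hole b K :=
  let i : 'I_2 := if b then 1 else 0 in let k : 'I_2 := if b then 0 else 1 in
  [&& (K i 0 != 0) (+) (K i 1 != 0), K k 0 != 0 & K k 1 != 0].

Definition nondegenerate K :=
  [&& (K 0 0 != 0) || (K 0 1 != 0), (K 1 0 != 0) || (K 1 1 != 0),
      (K 0 0 != 0) || (K 1 0 != 0) & (K 0 1 != 0) || (K 1 1 != 0)].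

Definition monomial22 K :=
  [&& (K 0 0 != 0) == (K 1 1 != 0), (K 0 1 != 0) == (K 1 0 != 0)
    & (K 0 0 != 0) (+) (K 0 1 != 0)].

(** The absolute value of [cross K] is the distance between the columns of [K] in
    the tropical projective line. *)
Definition cross K : int :=
  odflt 0 (K 0 0) + odflt 0 (K 1 1) - odflt 0 (K 0 1) - odflt 0 (K 1 0).

Definition supp22E := (mulmx22E, Zmax_add_neq0, Zmax_mul_neq0).

Ltac case_supports :=
  repeat match goal with |- context [?x != 0] => case: (x != 0) end.

Lemma nondegenerate_cases K : nondegenerate K ->
  [\/ monomial22 K, full K | exists b, hole b K].
Proof.
move=> ndK; have : [|| monomial22 K, full K, hole true K | hole false K].
  by move: ndK; rewrite /monomial22 /full /hole /nondegenerate; case_supports.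
by case/or4P => ?; [constructor 1 | constructor 2 | |] => //; constructor 3;
   eexists; eassumption.
Qed.

Lemma hole_excl b K : hole b K -> ~~ full K /\ ~~ hole (~~ b) K.
Proof. by rewrite /hole /full; case: b; case_supports. Qed.

(** Row [b] of [K *m Y] is a multiple of a row of [Y], while the other row has
    finite entries because every column of [Y] has one: no -oo can appear
    outside row [b]. *)
Lemma hole_mul b K Y :
  hole b K -> nondegenerate (K *m Y) -> hole b (K *m Y) || full (K *m Y).
Proof. by rewrite /hole /nondegenerate /full !supp22E; case: b; case_supports. Qed.

Lemma full_mul K Y : full K -> nondegenerate (K *m Y) -> full (K *m Y).
Proof. by rewrite /nondegenerate /full !supp22E; case_supports. Qed.

(** The columns of [K *m Y] lie on the projective segment spanned by the columns
    of [K]. *)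
Lemma cross_mul_full K Y : full K -> full (K *m Y) ->
  `|cross (K *m Y)| <= `|cross K|.
Proof.
rewrite /full /cross !mulmx22E.
case: (K 0 0) (K 0 1) (K 1 0) (K 1 1) => [a|] [b|] [c|] [d|] // _.
by case: (Y 0 0) (Y 0 1) (Y 1 0) (Y 1 1) => [e|] [f|] [g|] [h|] //= _; lia.
Qed.

(** A monomial factor on the left scales or swaps rows, which can only change the
    sign of the cross difference. *)
Lemma cross_monomial_mul K Y : monomial22 K -> full (K *m Y) ->
  full Y /\ `|cross (K *m Y)| = `|cross Y|.
Proof.
rewrite /monomial22 /full /cross !mulmx22E.
case: (K 0 0) (K 0 1) (K 1 0) (K 1 1) => [a|] [b|] [c|] [d|] // _;
case: (Y 0 0) (Y 0 1) (Y 1 0) (Y 1 1) => [e|] [f|] [g|] [h|] //= _;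
by split => //; lia.
Qed.

(** A zero column of [K] would make the columns of [K *m Y] proportional. *)
Lemma nondegenerate_factor K Y :
  full (K *m Y) -> cross (K *m Y) != 0 -> nondegenerate K.
Proof.
rewrite /nondegenerate /full /cross !mulmx22E.
case: (K 0 0) (K 0 1) (K 1 0) (K 1 1) => [a|] [b|] [c|] [d|] //;
case: (Y 0 0) (Y 0 1) (Y 1 0) (Y 1 1) => [e|] [f|] [g|] [h|] //= _; lia.
Qed.

Lemma prefix_cases (T : Type) (p q x z : seq T) : p ++ q = x ++ z ->
  (exists s, x = p ++ s /\ q = s ++ z) \/ (exists s, p = x ++ s /\ z = s ++ q).
Proof.
elim: p x => [|a p IHp] [|b x] /=.
- by left; exists [::].
- by move=> ->; left; exists (b :: x).
- by move=> <-; right; exists (a :: p).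
by case=> -> /IHp [] [s [-> ->]]; [left|right]; exists s.
Qed.

Section Presentation.
Variables (A : finType) (phi : seq A -> 'M[Zmax]_2).
Hypothesis phi_cat : forall u v, phi (u ++ v) = phi u *m phi v.

(** The invariant of the two-dimensional case: the row of the hole, seen at some
    prefix.  It refers to all prefixes rather than to the first one whose value
    is not monomial, because a generator may be any matrix. *)
Definition prefix_hole b w := exists p q, w = p ++ q /\ hole b (phi p).

Definition wide (C : int) K := full K && (C < `|cross K|).

Lemma nondegenerate_prefix C p q :
  0 <= C -> wide C (phi (p ++ q)) -> nondegenerate (phi p).
Proof.
rewrite phi_cat => C0 /andP [fKY crossKY].
by apply: nondegenerate_factor fKY _; lia.
Qed.

(** Of two prefixes one extends the other, so their holes are in the same row. *)
Lemma prefix_hole_excl C b w : 0 <= C -> wide C (phi w) ->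
  prefix_hole b w -> prefix_hole (~~ b) w -> False.
Proof.
have incl d p s q : 0 <= C -> wide C (phi (p ++ s ++ q)) ->
    hole d (phi p) -> hole (~~ d) (phi (p ++ s)) -> False.
  rewrite catA => C0 /(nondegenerate_prefix C0) nd hp hps.
  move: nd; rewrite phi_cat => /(hole_mul hp); rewrite -phi_cat => hs.
  have [nf _] := hole_excl hps; move: hs; rewrite (negPf nf) orbF.
  by move=> /hole_excl []; rewrite hps.
move=> C0 ww [p [q [wpq hp]]] [p' [q' [wpq' hp']]].
move: wpq; rewrite wpq' => /prefix_cases [] [s [ps qs]].
  by subst p q'; apply: (incl (~~ b) p' s q); rewrite ?negbK // -wpq'.
by subst p' q; apply: (incl b p s q'); rewrite // catA -wpq'.
Qed.

(** If the prefix [p] with a hole ends inside [l], then it must be replaced by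
    another one: by [x ++ r] if the hole survives until the end of [l], and by
    [x] if [x] has a hole already.  In the remaining case [x] is monomial and
    [x ++ l] has finite entries; then [l] has the cross difference of [x ++ l],
    which is at least that of the whole word, against the bound on [l]. *)
Lemma prefix_hole_step C b x l r y : 0 <= C ->
  phi l = phi r -> `|cross (phi l)| <= C -> wide C (phi (x ++ l ++ y)) ->
  prefix_hole b (x ++ l ++ y) -> prefix_hole b (x ++ r ++ y).
Proof.
move=> C0 lr crossl wide_xly [p [q [/esym /prefix_cases pq hp]]].
(* The prefix [p] ends inside [x], or [s] is the part of [p] after [x]. *)
case: pq => [[s [-> _]]|[s [ps lyq]]].
  by exists p, (s ++ r ++ y); rewrite -catA.
(* If [p] reaches into [y], its value does not see the replacement. *)
case: (prefix_cases (esym lyq)) => [[t [lst qty]]|[t [slt yt]]]; last first.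
  exists (x ++ r ++ t), q; split; first by rewrite yt !catA.
  by rewrite -(_ : phi p = phi (x ++ r ++ t)) // ps slt !phi_cat lr.
have nd u v : x ++ l ++ y = u ++ v -> nondegenerate (phi u).
  by move=> E; apply: (@nondegenerate_prefix C _ v); rewrite -?E.
have nd_x : nondegenerate (phi x) by apply: nd.
have nd_xs : nondegenerate (phi (x ++ s)).
  by apply: (nd _ (t ++ y)); rewrite lst !catA.
have nd_xl : nondegenerate (phi (x ++ l)) by apply: (nd _ y); rewrite catA.
rewrite ps in hp.
have /orP [hxl|fxl] : hole b (phi (x ++ l)) || full (phi (x ++ l)).
  by move: nd_xl; rewrite lst catA [phi _]phi_cat => /(hole_mul hp).
  exists (x ++ r), y; split; first by rewrite catA.
  by rewrite phi_cat -lr -phi_cat.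
case: (nondegenerate_cases nd_x) => [mx|fx|[d hx]].
- exfalso; move: wide_xly fxl; rewrite catA phi_cat => /andP [fxly wxly] fxl.
  have := cross_mul_full fxl fxly; move: fxl; rewrite phi_cat.
  by move=> /(cross_monomial_mul mx) [_ ->]; move: wxly; rewrite phi_cat; lia.
- have [/negP[]] := hole_excl hp.
  by move: nd_xs; rewrite phi_cat; apply: full_mul.
have -> : b = d.
  move: nd_xs hp; rewrite phi_cat => /(hole_mul hx) hd /hole_excl [nf].
  by move: hd; rewrite (negPf nf) orbF; case: b d {hx} => [] [] // ->.
by exists x, (r ++ y).
Qed.

End Presentation.

Definition mx22 (a b c d : Zmax) : 'M[Zmax]_2 :=
  \matrix_(i, j) (if i == 0 then if j == 0 then a else b
                  else if j == 0 then c else d).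

Lemma mx22_mul (a b c d a' b' c' d' : Zmax) :
  mx22 a b c d *m mx22 a' b' c' d' =
  mx22 (a * a' + b * c') (a * b' + b * d') (c * a' + d * c') (c * b' + d * d').
Proof.
apply/matrixP => i j; rewrite mulmx22E !mxE /=.
by case: (i == 0); case: (j == 0).
Qed.

Lemma not_finitely_presented_dim2 :
  ~ finitely_presented (mulMonoid 'M[Zmax]_2).
Proof.
move=> /presentation_eval [A [R [phi [_ phiM phi_surj phiR]]]].
have phi_cat u v : phi (u ++ v) = (phi u : 'M_2) *m phi v by exact: phiM.
have [C C0 crossR] : exists2 C : int, 0 <= C &
    forall p, p \in R -> `|cross (phi p.1)| <= C.
  elim: R {phiR} => [|p R [C C0 IHR]]; first by exists 0.
  exists (C + `|cross (phi p.1)|); first by rewrite addr_ge0.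
  move=> q; rewrite inE => /predU1P [->|/IHR crossq]; first by rewrite lerDr.
  by apply: le_trans crossq _; rewrite lerDl.
(* Compatibility is required in every context, to make it a congruence, and only
   where the whole word is wide, since only there is the row of
   the hole unambiguous. *)
pose compat u v := phi u = phi v /\ forall x y, wide C (phi (x ++ u ++ y)) ->
  forall b, prefix_hole phi b (x ++ u ++ y) <-> prefix_hole phi b (x ++ v ++ y).
have phi_ctx u v x y :
    phi u = phi v -> phi (x ++ u ++ y) = phi (x ++ v ++ y).
  by move=> uv; rewrite !phi_cat uv.
have compat_refl u : compat u u by [].
have compat_sym u v : compat u v -> compat v u.
  case=> uv H; split=> // x y; rewrite -(phi_ctx u v) // => wxy b.
  by split=> /H; apply.
have compat_trans u v w : compat u v -> compat v w -> compat u w.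
  case=> uv Huv [vw Hvw]; split=> [|x y wu b]; first by rewrite uv.
  rewrite Huv // Hvw //; by rewrite -(phi_ctx u v).
have compat_mul u u' v v' :
    compat u u' -> compat v v' -> compat (u ++ v) (u' ++ v').
  case=> uu' Hu [vv' Hv]; split=> [|x y wuv b].
    by rewrite !phi_cat uu' vv'.
  rewrite -!catA in wuv *; rewrite Hu // catA Hv -?catA //.
  by rewrite -(phi_ctx u u').
pose compat_cong := @MonoidCongruence (freeMonoid A) compat
  compat_refl compat_sym compat_trans compat_mul.
have compatR u v : phi u = phi v -> compat u v.
  move=> /phiR; apply: (_ : _ -> compat_cong u v); apply => p Rp.
  have p12 : phi p.1 = phi p.2 by apply/phiR/generatedCongruence_sub.
  have crossp := crossR _ Rp.
  split=> // x y w b; split; first exact: (prefix_hole_step phi_cat C0 p12).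
  apply: (prefix_hole_step phi_cat C0 (esym p12)); first by rewrite -p12.
  by rewrite -(phi_ctx p.1).
pose s := Some (C + 1) : Zmax; pose s' := Some (- (C + 1)) : Zmax.
(* The value of [u1] has its hole in row 0, and that of [u2] in row 1. *)
have [u1 phi_u1] := phi_surj (mx22 1 0 1 1).
have [v1 phi_v1] := phi_surj (mx22 1 1 0 s).
have [u2 phi_u2] := phi_surj (mx22 1 s' 0 1).
have [v2 phi_v2] := phi_surj (mx22 1 0 1 s).
have phi1 : phi (u1 ++ v1) = mx22 1 1 1 s.
  rewrite phi_cat phi_u1 phi_v1 mx22_mul /s; congr mx22; congr Some; lia.
have phi2 : phi (u2 ++ v2) = mx22 1 1 1 s.
  rewrite phi_cat phi_u2 phi_v2 mx22_mul /s; congr mx22; congr Some; lia.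
have wide1 : wide C (phi (u1 ++ v1)).
  by rewrite phi1 /wide /full /cross !mxE /=; lia.
apply: (prefix_hole_excl phi_cat C0 wide1 (b := false)).
  by exists u1, v1; rewrite phi_u1 /hole !mxE.
have [_ /(_ [::] [::])] := compatR _ _ (etrans phi1 (esym phi2)).
rewrite !cats0 !cat0s => /(_ wide1 true) [_]; apply.
by exists u2, v2; rewrite phi_u2 /hole !mxE.
Qed.

End DimensionTwo.

(** * Monomial matrices and permutation weights *)

Section Monomial.
Local Open Scope ring_scope.
Variable n : nat.
Implicit Types (X Y M : 'M[Zmax]_n) (s t : 'S_n).

Lemma mulmx_neq0 X Y i k :
  ((X *m Y) i k != 0) = [exists j, (X i j != 0) && (Y j k != 0)].
Proof.
rewrite mxE (big_morph (fun x : Zmax => x != 0) Zmax_add_neq0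
  (erefl : (0 != 0 :> Zmax) = false)).
by rewrite big_orE; apply: eq_existsb => j; rewrite Zmax_mul_neq0.
Qed.

Definition monomial X := exists s, forall i j, (X i j != 0) = (j == s i).

Lemma monomial1 : monomial 1%:M.
Proof. by exists 1%g => i j; rewrite perm1 mxE [RHS]eq_sym; case: (i == j). Qed.

Lemma monomial_mull X Y s : (forall i j, (X i j != 0) = (j == s i)) ->
  forall i k, (X *m Y) i k = X i (s i) * Y (s i) k.
Proof.
move=> Xs i k; rewrite mxE (bigD1 (s i)) //= big1 ?addr0 // => j.
by rewrite -Xs negbK => /eqP ->; rewrite mul0r.
Qed.

Lemma monomial_mulr X Y s : (forall i j, (Y i j != 0) = (j == s i)) ->
  forall i k, (X *m Y) i k = X i (s^-1%g k) * Y (s^-1%g k) k.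
Proof.
move=> Ys i k; rewrite mxE (bigD1 (s^-1%g k)) //= big1 ?addr0 // => j.
rewrite -(inj_eq (@perm_inj _ s)) permKV eq_sym -Ys negbK => /eqP ->.
by rewrite mulr0.
Qed.

Lemma monomial_mul X Y : monomial X -> monomial Y -> monomial (X *m Y).
Proof.
move=> [s Xs] [t Yt]; exists (s * t)%g => i k.
by rewrite (monomial_mull _ Xs) Zmax_mul_neq0 Xs Yt eqxx permM.
Qed.

Lemma monomial_cancel X Y : monomial X -> monomial (X *m Y) -> monomial Y.
Proof.
move=> [s Xs] [t XYt]; exists (s^-1 * t)%g => i k.
rewrite permM -XYt (monomial_mull _ Xs) Zmax_mul_neq0 Xs eqxx.
by rewrite permKV.
Qed.

(** Monomial matrices play the role of the units. *)
Definition irreducible M :=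
  ~ monomial M /\ forall X Y, M = X *m Y -> monomial X \/ monomial Y.

Lemma irreducible_cancel X M :
  monomial X -> irreducible (X *m M) -> irreducible M.
Proof.
move=> mX [nXM irrXM]; split=> [mM|Y Z MYZ]; first exact/nXM/monomial_mul.
case: (irrXM (X *m Y) Z); rewrite ?MYZ ?mulmxA //; last by right.
by move=> /(monomial_cancel mX); left.
Qed.

Definition weight M s : Zmax := \prod_i M i (s i).

(** Monomial factors add one constant to all finite weights, so their differences
    are an invariant up to monomial factors. *)
Definition spread_le (C : int) M := forall s t x y,
  weight M s = Some x -> weight M t = Some y -> x - y <= C.

Lemma spread_le_scale C M N (c : Zmax) (h : 'S_n -> 'S_n) :
  (forall s, weight N s = c * weight M (h s)) ->
  spread_le C M -> spread_le C N.
Proof.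
move=> wN spM s t x y; rewrite !wN; case: c {wN} => // c.
case Es: weight => [x'|] //; case Et: weight => [y'|] // [<-] [<-].
by have := spM _ _ _ _ Es Et; lia.
Qed.

Lemma spread_le_mull C X M :
  monomial X -> spread_le C M -> spread_le C (X *m M).
Proof.
move=> [u Xu]; apply: (@spread_le_scale _ _ _ (weight X u) (fun s => u^-1 * s)%g).
move=> s; rewrite /weight (eq_bigr _ (fun i _ => monomial_mull M Xu i _)).
rewrite big_split; congr (_ * _); rewrite [RHS](reindex_inj (@perm_inj _ u)).
by apply: eq_bigr => i _; rewrite permM permK.
Qed.

Lemma spread_le_mulr C X M :
  monomial X -> spread_le C M -> spread_le C (M *m X).
Proof.
move=> [u Xu]; apply: (@spread_le_scale _ _ _ (weight X u) (fun s => s * u^-1)%g).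
move=> s; rewrite /weight (eq_bigr _ (fun i _ => monomial_mulr M Xu i _)).
rewrite big_split mulrC; congr (_ * _).
  by apply: eq_bigr => i _; rewrite permM.
rewrite [RHS](reindex_inj (@perm_inj _ (s * u^-1)%g)).
by apply: eq_bigr => i _; rewrite permM permKV.
Qed.

Definition spread_bound M : int :=
  \sum_(p : 'S_n * 'S_n) `|odflt 0 (weight M p.1) - odflt 0 (weight M p.2)|.

Lemma spread_boundP M : spread_le (spread_bound M) M.
Proof.
move=> s t x y Ms Mt; rewrite /spread_bound (bigD1 (s, t)) //= Ms Mt /=.
by apply: ler_wpDr; [apply: sumr_ge0 | apply: ler_norm].
Qed.

(** Split the first letter off an irreducible word.  One factor is monomial:
    if it is the letter, the rest is still irreducible with the same spread; if
    it is the rest, the word has the spread of its first letter. *)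
Lemma spread_bounded_of_generated (A : finType) (phi : seq A -> 'M[Zmax]_n) :
  phi [::] = 1%:M -> (forall u v, phi (u ++ v) = phi u *m phi v) ->
  exists C, forall u, irreducible (phi u) -> spread_le C (phi u).
Proof.
move=> phi1 phi_cat; exists (\sum_a spread_bound (phi [:: a])) => u.
elim: u => [|a u IHu]; first by rewrite phi1 => -[] /(_ monomial1).
rewrite -cat1s phi_cat => irr_au; have [_ /(_ _ _ erefl) [ma|mu]] := irr_au.
  exact/(spread_le_mull ma)/IHu/(irreducible_cancel ma).
apply: (spread_le_mulr mu) => s t x y as_ at_.
apply: le_trans (spread_boundP as_ at_) _.
by rewrite (bigD1 a) //= lerDl; apply: sumr_ge0 => b _; apply: sumr_ge0.
Qed.

End Monomial.

(** * Dimension at least three *)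

Section DimensionAtLeastThree.
Local Open Scope ring_scope.
Variable m : nat.
Local Notation I := 'I_m.+3.
Implicit Types (X Y : 'M[Zmax]_m.+3) (i j k : I).

Lemma cyc_ind (P : I -> Prop) : (forall i, P i -> P (i + 1)) ->
  forall i j, P i -> P j.
Proof.
move=> PS i j Pi; rewrite -(subrK i j) addrC -(natr_Zp (j - i)).
elim: (val (j - i)) => [|k IHk]; first by rewrite addr0.
by rewrite -natr1 addrA; apply: PS.
Qed.

Lemma addI1_neq i : (i + 1 == i) = false.
Proof. by rewrite -[X in _ == X]addr0 (inj_eq (addrI i)). Qed.

Lemma addI2_neq i : (i + 1 + 1 == i) = false.
Proof. by rewrite -addrA -[X in _ == X]addr0 (inj_eq (addrI i)). Qed.

(** The support is a cycle of length 2n in the bipartite graph of rows and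
    columns, and every inner index contributes a complete bipartite subgraph of
    it, hence, as there is no 4-cycle, at most two adjacent edges.  So the [n]
    inner indices cut the cycle into paths of length 2.  Going round, these paths
    are either all centred at rows, which makes [X] monomial, or all centred at
    columns, which makes [Y] monomial. *)
Lemma cycle_support_irreducible X Y :
  (forall i k, ((X *m Y) i k != 0) = (k == i) || (k == i + 1)) ->
  monomial X \/ monomial Y.
Proof.
move=> XY.
have XYE i j k : X i j != 0 -> Y j k != 0 -> k = i \/ k = i + 1.
  move=> Xij Yjk; apply/pred2P; rewrite -[_ || _]/(pred2 _ _ _) /= -XY.
  by rewrite mulmx_neq0; apply/existsP; exists j; rewrite Xij.
(* Index of a path covering the diagonal edge (i, i); [g] below is for (i, i + 1). *)
have /fin_all_exists [f fP] i : exists j, (X i j != 0) /\ (Y j i != 0).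
  have := XY i i; rewrite eqxx mulmx_neq0 => /existsP [j /andP].
  by exists j.
have /fin_all_exists [g gP] i : exists j, (X i j != 0) /\ (Y j (i + 1) != 0).
  have := XY i (i + 1); rewrite eqxx orbT mulmx_neq0 => /existsP [j /andP].
  by exists j.
have f_inj : injective f.
  move=> i j fij; have [Xi Yi] := fP i; have [Xj Yj] := fP j.
  rewrite fij in Xi Yi; case: (XYE _ _ _ Xi Yj) => [//|ji].
  case: (XYE _ _ _ Xj Yi) => [//|ij]; move: (addI2_neq i).
  by rewrite -ji -ij eqxx.
have g_inj : injective g.
  move=> i j gij; have [Xi Yi] := gP i; have [Xj Yj] := gP j.
  rewrite gij in Xi Yi; case: (XYE _ _ _ Xi Yj) => [ji|/addIr //].
  case: (XYE _ _ _ Xj Yi) => [ij|/addIr //]; move: (addI2_neq i).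
  by rewrite ij ji eqxx.
have fg i j : f i = g j -> i = j \/ i = j + 1.
  move=> fgij; have [Xi Yi] := fP i; have [Xj Yj] := gP j.
  by rewrite -fgij in Xj; apply: XYE Xj Yi.
have ex_g k : exists j, k = g j by exists (invF g_inj k); rewrite f_invF.
(* If one path covers both edges of row [i], the superdiagonal edge of row [i] is
   taken, so the diagonal edge of row [i + 1] can only be joined to the other
   edge of its own row. *)
case: (pselect (exists i, f i = g i)) => [[i0 fgi0]|fg_neq].
  have {i0 fgi0} fgE i : f i = g i.
    apply: (@cyc_ind (fun i => f i = g i) _ i0) => // {i i0 fgi0} i fgi.
    have [j fgj] := ex_g (f (i + 1)); case: (fg _ _ fgj) => [ij|/addIr ij].
      by rewrite fgj ij.
    by move: fgj; rewrite -ij -fgi => /f_inj /eqP; rewrite addI1_neq.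
  left; exists (perm f_inj) => i k; rewrite permE.
  apply/idP/eqP => [Xik|->]; last by have [] := fP i.
  have [j kgj] := ex_g k; rewrite kgj -fgE in Xik *.
  congr f; have [_ Yjj] := fP j; have [_ Yjj1] := gP j; rewrite -fgE in Yjj1.
  case: (XYE _ _ _ Xik Yjj) => // ji; case: (XYE _ _ _ Xik Yjj1) => /eqP.
    by rewrite ji addI2_neq.
  by rewrite ji addI1_neq.
(* Here [f i] also covers the other edge of column [i]. *)
right; exists (perm f_inj)^-1%g => k j.
rewrite -{1}[k](permKV (perm f_inj)); move: ((perm f_inj)^-1%g k) => i {k}.
rewrite permE.
apply/idP/eqP => [Yij|->]; last by have [] := fP i.
have [Xi _] := fP i; have [l fgl] := ex_g (f i).
have [Xl _] := gP l; rewrite -fgl in Xl.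
case: (XYE _ _ _ Xi Yij) => // ji1; case: (fg _ _ fgl) => il.
  by case: fg_neq; exists i; rewrite {2}il.
by case: (XYE _ _ _ Xl Yij) => /eqP; rewrite ji1 il ?addI2_neq ?addI1_neq.
Qed.

Definition cycle_mx (a : int) : 'M[Zmax]_m.+3 :=
  \matrix_(i, j) (if j == i then 1
                  else if j == i + 1 then if i == 0 then Some a : Zmax else 1
                  else 0).

Lemma cycle_mx_neq0 a i j : (cycle_mx a i j != 0) = (j == i) || (j == i + 1).
Proof.
by rewrite mxE; case: (j == i) => //; case: (j == i + 1) => //; case: (i == 0).
Qed.

Lemma cycle_mx_irreducible a : irreducible (cycle_mx a).
Proof.
split=> [[s cs]|X Y aXY].
  have := cs 0 (0 + 1); have := cs 0 0.
  rewrite !cycle_mx_neq0 !eqxx orbT => /esym/eqP <- /esym.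
  by rewrite addI1_neq.
by apply: cycle_support_irreducible => i k; rewrite -aXY cycle_mx_neq0.
Qed.

Lemma cycle_mx_spread a C : spread_le C (cycle_mx a) -> a <= C.
Proof.
move=> /(_ (perm (addIr 1)) 1%g a 0); rewrite subr0; apply.
  rewrite /weight (bigD1 0) //= big1 => [|i /negPf i0].
    by rewrite mulr1 mxE permE addI1_neq !eqxx.
  by rewrite mxE permE addI1_neq eqxx i0.
by rewrite /weight big1 // => i _; rewrite mxE perm1 eqxx.
Qed.

Lemma not_finitely_presented_dim_ge3 :
  ~ finitely_presented (mulMonoid 'M[Zmax]_m.+3).
Proof.
move=> /presentation_eval [A [_ [phi [phi1 phiM phi_surj _]]]].
have [C spreadC] := spread_bounded_of_generated phi1 phiM.
have [u phi_u] := phi_surj (cycle_mx (C + 1)).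
have /cycle_mx_spread : spread_le C (cycle_mx (C + 1)).
  by rewrite -phi_u; apply: spreadC; rewrite phi_u; apply: cycle_mx_irreducible.
lia.
Qed.

End DimensionAtLeastThree.

(** * The characterization *)

Theorem corollary5p8 (n : nat) (n_gt0 : 0 < n) :
  finitely_presented (mulMonoid 'M[Zmax]_n) <-> n = 1.
Proof.
split=> [|->]; last exact: finitely_presented_dim1.
case: n n_gt0 => [|[|[|m]]] // _.
  by move=> /not_finitely_presented_dim2.
by move=> /not_finitely_presented_dim_ge3.
Qed.
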